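(* Let $A=(a_1,\ldots,a_n)\in\mathbb N^n$ (positive integers) with $a_1<\cdots<a_n$, and let $\mathrm{sh}^{(n)}$ be realized as $\mathrm{sh}_A\subset\mathbb P(M^A)$. Then $F_A=\bigoplus_{k\ge0}(M^{A(k)})^*$ is the coordinate ring of $\mathrm{sh}^{(n)}$. That is, if $v_1,\ldots,v_N$ is a basis of $M^A$ and $\xi_1,\ldots,\xi_N\in(M^A)^*=(M^{A(1)})^*$ is the dual basis, then a homogeneous polynomial $p$ in $N$ variables satisfies $p(x_1,\ldots,x_N)=0$ for all points $(x_1:\cdots:x_N)\in\mathrm{sh}^{(n)}$ if and only if $p(\xi_1,\ldots,\xi_N)=0$ in $F_A$.
   Context: Fusion products. Let $e,h,f$ be the standard basis of $\mathfrak{sl}_2(\mathbb C)$ and write $x_j=x\otimes t^j$. For positive integers $A=(a_1,\ldots,a_n)$ choose pairwise distinct $z_1,\ldots,z_n\in\mathbb C$, let $\mathbb C^{a}$ be the $a$-dimensional irreducible $\mathfrak{sl}_2$-module, and $\mathbb C^{a_i}(z_i)$ the $\mathfrak{sl}_2\otimes\mathbb C[t]$-module on which $x_j$ acts as $z_i^jx$. Let $\overline{v_A}\in\bigotimes_i\mathbb C^{a_i}(z_i)$ be the tensor product of lowest weight vectors and $F_s$ the span of all $x^{(1)}_{i_1}\cdots x^{(k)}_{i_k}\overline{v_A}$ with $x^{(j)}\in\mathfrak{sl}_2$, $i_1+\cdots+i_k\le s$. The fusion product is the associated graded $\mathfrak{sl}_2\otimes\mathbb C[t]$-module $M^A=\bigoplus_sF_s/F_{s-1}$,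 with $v_A$ the image of $\overline{v_A}$. Known facts: $\mathfrak{sl}_2\otimes t^j$ acts by $0$ for $j\ge n$; $M^A=\mathbb C[e_0,\ldots,e_{n-1}]v_A\simeq\mathbb C[e_0,\ldots,e_{n-1}]/I_A$ with $I_A$ generated by $\sum_{i_1+\cdots+i_k=s}e_{n-1-i_1}\cdots e_{n-1-i_k}$ for $k\ge1$, $s<\sum_{j=1}^n\max(k+1-a_j,0)$ (so $M^A$ does not depend on the $z_i$); $\dim M^A=\prod a_i$. Schubert variety. $\mathrm G=SL_2(\mathbb C[t]/t^n)$ acts on $M^A$ and on $\mathbb P(M^A)$; $[v]$ denotes the line $\mathbb Cv$; $\mathrm{sh}_A=\overline{\mathrm G\cdot[v_A]}\subset\mathbb P(M^A)$. For $a_1<\cdots<a_n$ the variety $\mathrm{sh}_A$, regarded up to isomorphism as depending only on $n$, is denoted $\mathrm{sh}^{(n)}$. The algebra $F_A$. $A(k)=(ka_1-k+1,\ldots,ka_n-k+1)$ for $k\ge1$, and $(M^{A(0)})^*:=\mathbb C$. For $k,l\ge1$ there is an embedding of $\mathfrak{sl}_2\otimes\mathbb C[t]$-modules $M^{A(k+l)}\hookrightarrow M^{A(k)}\otimes M^{A(l)}$, $v_{A(k+l)}\mapsto v_{A(k)}\otimes v_{A(l)}$; the multiplication $(M^{A(k)})^*\otimes(M^{A(l)})^*\to(M^{A(k+l)})^*$ in the graded algebra $F_A$ is its dual, a surjection, so $F_A$ is generated by its degree one component $(M^A)^*$. (Equivalently, realizing $(M^{A})^*$ as the space of symmetric polynomials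 $f(z_1,\ldots,z_s)$, $s\ge0$, of degree $<n$ in each variable, such that $f(z,\ldots,z,z_{i+1},\ldots,z_s)$, with $i$ arguments equal to $z$, is divisible by $z^{\sum_j\max(i+1-a_j,0)}$ for all $i\ge1$, the product of $f(z_1,\ldots,z_{s_1})$ and $g(z_1,\ldots,z_{s_2})$ is the sum over all ways of splitting $\{z_1,\ldots,z_{s_1+s_2}\}$ into subsets of sizes $s_1$ and $s_2$ of the product of $f$ evaluated on the first and $g$ on the second.) *)

(* Defs.v *)
From HB Require Import structures.
From mathcomp Require Import all_boot all_order all_algebra.
From mathcomp Require Import reals complex mpoly.

Set Implicit Arguments.
Unset Strict Implicit.
Unset Printing Implicit Defensive.

Import GRing.Theory.
Local Open Scope ring_scope.

(* All spans and actions below are multilinear in the elements of sl_2, so it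
   is enough to let these run over the standard basis. *)
Inductive sl2_basis : Type := sl2_e | sl2_h | sl2_f.

(* The irreducible a-dimensional representation in a basis w_0, .., w_(a-1):
     e w_q = w_(q+1),  h w_q = (2q - (a-1)) w_q,  f w_q = q (a-q) w_(q-1).
   The entry (p, q) is the coefficient of w_p in x w_q. The vector w_0 is a
   lowest weight vector. *)
Definition sl2_irr (K : fieldType) (a : nat) (x : sl2_basis) : 'M[K]_a :=
  \matrix_(p, q)
    match x with
    | sl2_e => ((p : nat) == q.+1)%:R
    | sl2_h => if p == q then (q * 2)%:R - a.-1%:R else 0
    | sl2_f => if (q : nat) == p.+1 then (q * (a - q))%:R else 0
    end.

(* The tensor product of the K^(a_i): coordinates in the basis of the
   w_(c 0) (x) .. (x) w_(c (n-1)). *)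
Notation tensor_space K a :=
  {ffun {dffun forall i : 'I_ _, 'I_(a i)} -> GRing.regular K}.

Section EvaluationModule.
Variables (K : fieldType) (n : nat) (a : 'I_n -> nat) (z : 'I_n -> K).

Definition eval_act (x : sl2_basis) (j : nat) (u : tensor_space K a) :
    tensor_space K a :=
  [ffun c : {dffun forall i : 'I_n, 'I_(a i)} =>
    \sum_(i < n) z i ^+ j *
      \sum_(q < a i) sl2_irr K (a i) x (c i) q * u (finfun (dfwith c q))].

Definition lowest_vec : tensor_space K a :=
  [ffun c : {dffun forall i : 'I_n, 'I_(a i)} =>
    [forall i, (c i : nat) == 0]%:R].

(* The word [:: (x1, i1); ..; (xk, ik)] stands for x1_{i1} .. xk_{ik}. *)
Definition word_act (w : seq (sl2_basis * nat)) (u : tensor_space K a) :=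
  foldr (fun xj => eval_act xj.1 xj.2) u w.

Definition word_deg (w : seq (sl2_basis * nat)) : nat := sumn (unzip2 w).

Definition filt (s : nat) (u : tensor_space K a) : Prop :=
  exists (r : nat) (c : 'I_r -> K) (w : 'I_r -> seq (sl2_basis * nat)),
    (forall i, (word_deg (w i) <= s)%N) /\
    u = \sum_(i < r) c i *: word_act (w i) lowest_vec.

Definition filt_pred (s : nat) (u : tensor_space K a) : Prop :=
  if s is s'.+1 then filt s' u else u = 0.

(* A model of the associated graded module of the filtration: fp_symb s is, on
   F_s, the composite of F_s -> F_s / F_(s-1) with the inclusion of the
   degree s component (its values outside F_s are irrelevant). The second to
   fifth conditions say that the carrier is the direct sum of the
   F_s / F_(s-1), s >= 0. *)
Record fusion_product : Type := FusionProduct {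
  fp_sort :> vectType K;
  fp_act : sl2_basis -> nat -> 'End(fp_sort);
  fp_vec : fp_sort;
  fp_symb : nat -> tensor_space K a -> fp_sort;
  fp_vecE : fp_vec = fp_symb 0 lowest_vec;
  fp_symb_linear : forall s (b : K) u w, filt s u -> filt s w ->
    fp_symb s (b *: u + w) = b *: fp_symb s u + fp_symb s w;
  fp_symb_ker : forall s u, filt s u -> (fp_symb s u = 0 <-> filt_pred s u);
  fp_symb_span : forall m : fp_sort, exists D (u : nat -> tensor_space K a),
    (forall s, filt s (u s)) /\ m = \sum_(s < D) fp_symb s (u s);
  fp_symb_direct : forall D (u : nat -> tensor_space K a),
    (forall s, filt s (u s)) -> \sum_(s < D) fp_symb s (u s) = 0 ->
    forall s, (s < D)%N -> fp_symb s (u s) = 0;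
  fp_actE : forall x j s u, filt s u ->
    fp_act x j (fp_symb s u) = fp_symb (s + j)%N (eval_act x j u)
}.

End EvaluationModule.

Arguments fp_vec {K n a z} f.
Arguments fp_act {K n a z} f x j.

(* The group SL_2(K[t]/t^n). For n = 0 the library reads {poly %/ 1} as
   K[t]/t, which is harmless since sl_2[t] then acts by 0. *)
Notation trunc_poly K n := {poly %/ ('X^n : {poly K})}.

Section GroupAction.
Variables (K : fieldType) (n : nat) (a : 'I_n -> nat) (z : 'I_n -> K).
Variable M : fusion_product a z.

(* The action of x (x) P for a class P = sum_j P_j t^j in K[t]/t^n. *)
Definition trunc_act (x : sl2_basis) (P : trunc_poly K n) : 'End(M) :=
  \sum_(j < n) (P : {poly K})`_j *: fp_act M x j.

(* The exponential of a nilpotent endomorphism phi: phi ^ k vanishes for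
   k >= dim M. *)
Definition nilp_exp (phi : 'End(M)) (m : M) : M :=
  \sum_(k < (\dim {: M}).+1) (k`!%:R)^-1 *: iter k phi m.

Definition unip (i j : 'I_2) (P : trunc_poly K n) : 'M[trunc_poly K n]_2 :=
  1%:M + P *: delta_mx i j.

(* The action of SL_2(K[t]/t^n) on M obtained by integrating the action of its
   Lie algebra. The ring K[t]/t^n being local, its SL_2 is generated by the
   elementary matrices exp(e P) and exp(f P), so the action is determined by
   these conditions. The values of gact outside SL_2 are irrelevant. *)
Record SL2_action : Type := SL2Action {
  gact :> 'M[trunc_poly K n]_2 -> 'End(M);
  gact1 : gact 1%:M = \1%VF;
  gactM : forall g h, \det g = 1 -> \det h = 1 ->
    gact (g *m h) = (gact g \o gact h)%VF;
  gact_exp_e : forall P m,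
    gact (unip 0 1 P) m = nilp_exp (trunc_act sl2_e P) m;
  gact_exp_f : forall P m,
    gact (unip 1 0 P) m = nilp_exp (trunc_act sl2_f P) m
}.

End GroupAction.

(* Points of the projective space P(V) are the lines of V, i.e. the subspaces
   of dimension 1. *)
Section Zariski.
Variables (K : fieldType) (V : vectType K).

Definition homog_poly_fun (phi : V -> K) : Prop :=
  exists (r d : nat) (l : 'I_r -> 'Hom(V, K^o)) (q : {mpoly K[r]}),
    q \is d.-homog /\ (forall m, phi m = q.@[fun i => l i m]).

Definition zariski_closed (Z : {vspace V} -> Prop) : Prop :=
  exists S : (V -> K) -> Prop,
    (forall phi, S phi -> homog_poly_fun phi) /\
    (forall L, Z L <->
       (\dim L = 1%N /\ forall phi, S phi -> forall m, m \in L -> phi m = 0)).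

Definition zariski_closure (Y : {vspace V} -> Prop) (L : {vspace V}) : Prop :=
  forall Z, zariski_closed Z -> (forall L', Y L' -> Z L') -> Z L.

End Zariski.

Section Schubert.
Variables (K : fieldType) (n : nat) (a : 'I_n -> nat) (z : 'I_n -> K).
Variables (M : fusion_product a z) (rho : SL2_action M).

Definition orbit_line (L : {vspace M}) : Prop :=
  exists g : 'M[trunc_poly K n]_2,
    \det g = 1 /\ L = <[rho g (fp_vec M)]>%VS.

Definition schubert : {vspace M} -> Prop := zariski_closure orbit_line.

End Schubert.

(* The tuple A(k); one has A(1) = A when all a_i are positive. *)
Definition Ak (n : nat) (a : 'I_n -> nat) (k : nat) (i : 'I_n) : nat :=
  (k * a i - k + 1)%N.

Lemma Ak1 (n : nat) (a : 'I_n -> nat) :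
  (forall i, 0 < a i)%N -> Ak a 1 =1 a.
Proof. by move=> a_gt0 i; rewrite /Ak mul1n subnK. Qed.

Notation dual M := 'Hom(M, (GRing.regular _)).

(* The tensor product of finite dimensional spaces M and N, realized as
   Hom(M^*, N): the pure tensor m (x) m' is the map xi |-> xi(m) m', and for
   t in M (x) N the value of xi (x) eta at t is eta (t xi). *)
Definition pure_tensor (K : fieldType) (M N : vectType K) (m : M) (m' : N) :
  dual M -> N := fun xi => (xi m : K) *: m'.

(* x (x) 1 + 1 (x) x, the first factor acting through xi |-> xi \o x. *)
Definition tensor_act (K : fieldType) (M N : vectType K)
    (xM : 'End(M)) (xN : 'End(N)) (t : 'Hom(dual M, N)) : dual M -> N :=
  fun xi => t (xi \o xM)%VF + xN (t xi).

Record fusion_embedding (K : fieldType) (n : nat) (a b c : 'I_n -> nat)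
    (z : 'I_n -> K) (P : fusion_product c z)
    (M : fusion_product a z) (N : fusion_product b z) : Type :=
  FusionEmbedding {
  emb :> 'Hom(P, 'Hom(dual M, N));
  emb_inj : lker emb = 0%VS;
  emb_act : forall x j w,
    emb (fp_act P x j w) =1 tensor_act (fp_act M x j) (fp_act N x j) (emb w);
  emb_vec : emb (fp_vec P) =1 pure_tensor (fp_vec M) (fp_vec N)
}.

Section CoordinateAlgebra.
Variables (K : fieldType) (n : nat) (a : 'I_n -> nat) (z : 'I_n -> K).
Variable M : forall k, fusion_product (Ak a k) z.
Variable iota : forall k l, (0 < k)%N -> (0 < l)%N ->
  fusion_embedding (M (k + l)%N) (M k) (M l).

(* The graded algebra F_A, with degree 0 component the scalars and, for k > 0,
   degree k component the image of (M^{A(k)})^* under FA_in k. The space M 0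
   plays no role. *)
Record FA_algebra : Type := FAAlgebra {
  FA_sort :> comAlgType K;
  FA_in : forall k, {linear dual (M k) -> FA_sort};
  FA_span : forall y : FA_sort,
    exists D (c : K) (xi : forall k, dual (M k)),
      y = c%:A + \sum_(1 <= k < D) FA_in k (xi k);
  FA_direct : forall D (c : K) (xi : forall k, dual (M k)),
    c%:A + \sum_(1 <= k < D) FA_in k (xi k) = 0 ->
    c = 0 /\ forall k, (1 <= k < D)%N -> xi k = 0;
  FA_mul : forall k l (k_gt0 : (0 < k)%N) (l_gt0 : (0 < l)%N)
      (xi : dual (M k)) (eta : dual (M l)) (zeta : dual (M (k + l)%N)),
    (forall w, zeta w = eta (iota k_gt0 l_gt0 w xi)) ->
    FA_in k xi * FA_in l eta = FA_in (k + l)%N zeta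
}.

Definition FA_eval (F : FA_algebra) (N : nat) (xi : 'I_N -> dual (M 1%N))
    (p : {mpoly K[N]}) : F :=
  mmap (in_alg F) (fun i => FA_in F 1%N (xi i)) p.

End CoordinateAlgebra.

(* Main.v *)
(* Let the x_j act on the polynomial functions on M^A as derivations (linear
   vector fields). Iterating the embeddings M^A(k+1) -> M^A (x) M^A(k), a
   polynomial p of degree d > 0 restricts to a functional zeta_p on M^A(d):
   this is the value of p(xi_1, .., xi_N) in F_A. Restriction is
   sl_2[t]-equivariant and zeta_p(v_A(d)) = p(v_A).
   As M^A(d) is cyclic, zeta_p = 0 iff all the iterated derivatives of p along
   the e_j, f_j vanish at v_A. On the other hand p vanishes on sh_A iff it
   vanishes on the orbit of v_A. The polynomials vanishing on the orbit are
   stable under the e_j, f_j (take the derivative of s |-> p (exp (s x_j) g v_A)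
   at s = 0), and conversely, SL_2(K[t]/t^n) being generated by exponentials, a
   polynomial all of whose iterated derivatives vanish at v_A vanishes on the
   orbit by Taylor expansion. *)

Require Import Defs.
From HB Require Import structures.
From mathcomp Require Import all_boot all_order all_algebra.
From mathcomp Require Import reals complex mpoly ring zify.

Set Implicit Arguments.
Unset Strict Implicit.
Unset Printing Implicit Defensive.

Import GRing.Theory.
Local Open Scope ring_scope.

(** * Operators on single tensor factors and the evaluation action *)

Section TensorSpace.
Variables (K : fieldType) (n : nat) (a : 'I_n -> nat).
Implicit Types (c : {dffun forall i : 'I_n, 'I_(a i)}) (u w : tensor_space K a).

(** The operator [1 (x) .. (x) A (x) .. (x) 1] with [A] in place [i]. *)
Definition site (i : 'I_n) (A : 'M[K]_(a i)) u : tensor_space K a :=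
  [ffun c : {dffun forall i : 'I_n, 'I_(a i)} =>
    \sum_(q < a i) A (c i) q * u (finfun (dfwith c q))].

Fact site_is_linear i A : linear (site (i := i) A).
Proof.
move=> b u w; apply/ffunP=> c; rewrite !ffunE scaler_sumr -big_split /=.
by apply: eq_bigr => q _; rewrite !ffunE mulrDr /GRing.scale /= mulrCA.
Qed.
HB.instance Definition _ i A := GRing.isLinear.Build K
  (tensor_space K a) (tensor_space K a) _ (site (i := i) A) (site_is_linear A).

Lemma site_mul i (A B : 'M[K]_(a i)) u : site A (site B u) = site (A *m B) u.
Proof.
apply/ffunP=> c; rewrite !ffunE.
under eq_bigr => q _ do rewrite ffunE ffunE dfwith_in mulr_sumr.
rewrite exchange_big /=; apply: eq_bigr => r _.
rewrite mxE mulr_suml; apply: eq_bigr => q _; rewrite mulrA.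
congr (_ * u _); apply/ffunP=> j; rewrite !ffunE.
case: (eqVneq i j) => [<-|ij]; first by rewrite !dfwith_in.
by rewrite !dfwith_out // ffunE dfwith_out.
Qed.

Lemma site_comm i j (A : 'M[K]_(a i)) (B : 'M[K]_(a j)) u : i != j ->
  site A (site B u) = site B (site A u).
Proof.
move=> ij; apply/ffunP=> c; rewrite !ffunE.
under eq_bigr => q _ do rewrite ffunE ffunE dfwith_out // mulr_sumr.
under [RHS]eq_bigr => q _ do rewrite ffunE ffunE dfwith_out 1?eq_sym // mulr_sumr.
rewrite exchange_big /=; apply: eq_bigr => r _; apply: eq_bigr => q _.
rewrite mulrCA; congr (_ * (_ * u _)); apply/ffunP=> k; rewrite !ffunE.
case: (eqVneq j k) => [<-|jk].
  by rewrite dfwith_in dfwith_out // ffunE dfwith_in.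
rewrite dfwith_out // ffunE.
case: (eqVneq i k) => [<-|ik]; first by rewrite !dfwith_in.
by rewrite !dfwith_out // ffunE dfwith_out.
Qed.

Lemma siteB i (A B : 'M[K]_(a i)) u : site A u - site B u = site (A - B) u.
Proof.
apply/ffunP=> c; rewrite !ffunE -sumrB.
by apply: eq_bigr => q _; rewrite !mxE mulrBl.
Qed.

Variable z : 'I_n -> K.

Lemma eval_actE x j u :
  eval_act z x j u = \sum_(i < n) z i ^+ j *: site (sl2_irr K (a i) x) u.
Proof.
apply/ffunP=> c; rewrite ffunE sum_ffunE.
by apply: eq_bigr => i _; rewrite !ffunE.
Qed.

Fact eval_act_is_linear x j : linear (eval_act (a := a) z x j).
Proof.
move=> b u w; rewrite !eval_actE scaler_sumr -big_split /=.
by apply: eq_bigr => i _; rewrite linearP scalerDr !scalerA mulrC.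
Qed.
HB.instance Definition _ x j := GRing.isLinear.Build K
  (tensor_space K a) (tensor_space K a) _ (eval_act (a := a) z x j)
  (eval_act_is_linear x j).

(** On [w_q] the two products act by [q (b-q)] and [(q+1) (b-q-1)], which differ by [2q - (b-1)];
    the second scalar is zero at the top vector, which [e] kills. *)
Lemma sl2_irr_comm b : sl2_irr K b sl2_e *m sl2_irr K b sl2_f
  - sl2_irr K b sl2_f *m sl2_irr K b sl2_e = sl2_irr K b sl2_h.
Proof.
apply/matrixP=> p q; rewrite !mxE.
under eq_bigr => r _ do rewrite !mxE.
under [X in _ - X]eq_bigr => r _ do rewrite !mxE.
have -> : \sum_(r < b) ((p : nat) == r.+1)%:R *
    (if (q : nat) == r.+1 then (q * (b - q))%:R else 0)
   = (if p == q then (q * (b - q))%:R else 0 : K).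
  case: (posnP q) => [q0|q_gt0].
    rewrite big1 => [|r _]; last first.
      by rewrite [X in if X then _ else _](_ : _ = false) ?mulr0 ?q0.
    by rewrite q0 mul0n; case: ifP.
  have lt : (q.-1 < b)%N by rewrite (leq_ltn_trans (leq_pred _)).
  rewrite (bigD1 (Ordinal lt)) //= prednK // eqxx big1 => [|r].
    by rewrite addr0 -val_eqE /=; case: eqP => _; rewrite (mul1r, mul0r).
  rewrite -val_eqE /= => rq; 
    case: (eqVneq (q : nat) r.+1) => [qr|_]; last by rewrite mulr0.
  by rewrite qr eqxx in rq.
have -> : \sum_(r < b) (if (r : nat) == p.+1 then (r * (b - r))%:R else 0) *
    ((r : nat) == q.+1)%:R
   = (if p == q then (q.+1 * (b - q.+1))%:R else 0 : K).
  case: (ltnP q.+1 b) => [lt|le].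
    rewrite (bigD1 (Ordinal lt)) //= eqxx big1 => [|r].
      by rewrite addr0 mulr1 eqSS -val_eqE /= eq_sym.
    by rewrite -val_eqE /= => /negPf ->; rewrite mulr0.
  rewrite big1 => [|r _].
    by move: le; rewrite -subn_eq0 => /eqP ->; rewrite muln0; case: ifP.
  by rewrite (ltn_eqF (leq_trans (ltn_ord r) le : (r < q.+1)%N)) mulr0.
case: eqP => _; last by rewrite subr0.
have /subnKC := ltn_ord q; move: (nat_of_ord q) (b - q.+1)%N => r t <-.
rewrite addSnnS addKn addnS /=.
rewrite !natrM natrD !mulrS; ring.
Qed.

(** Operators at distinct sites commute, so only the terms with both factors at the same site [k]
    survive, with coefficient [z k ^+ (i + j)]. *)
Lemma eval_act_comm i j u :
  eval_act z sl2_e i (eval_act z sl2_f j u)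
  - eval_act z sl2_f j (eval_act z sl2_e i u) = eval_act z sl2_h (i + j) u.
Proof.
rewrite [eval_act z sl2_f j u]eval_actE (eval_actE sl2_f) linear_sum /=.
rewrite -sumrB [RHS]eval_actE; apply: eq_bigr => k _.
rewrite linearZ /= -scalerBr !eval_actE linear_sum -sumrB (bigD1 k) //=.
rewrite big1 ?addr0 => [|l lk].
  rewrite linearZ /= -scalerBr site_mul site_mul siteB sl2_irr_comm.
  by rewrite scalerA -exprD addnC.
by rewrite linearZ /= site_comm // subrr.
Qed.

End TensorSpace.

(** * The filtration and its associated graded module *)

Section Fusion.
Variables (K : fieldType) (n : nat) (a : 'I_n -> nat) (z : 'I_n -> K).
Implicit Types (u w : tensor_space K a).

Lemma filt_word s l : (word_deg l <= s)%N ->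
  filt z s (word_act z l (lowest_vec K a)).
Proof.
move=> ls; exists 1%N, (fun=> 1), (fun=> l); split=> //.
by rewrite big_ord1 scale1r.
Qed.

Lemma filt0 s : filt z s (0 : tensor_space K a).
Proof.
exists 0%N, (fun=> 0), (fun=> [::]); split=> [[]//|].
by rewrite big_ord0.
Qed.

Lemma filt_lin s (b : K) u w : filt z s u -> filt z s w -> filt z s (b *: u + w).
Proof.
move=> [r [c [l [ls ->]]]] [r' [c' [l' [ls' ->]]]].
exists (r + r')%N, (fun i => match split i with inl i => b * c i | inr i => c' i end),
  (fun i => match split i with inl i => l i | inr i => l' i end); split.
  by move=> i; case: (split i).
rewrite big_split_ord scaler_sumr /=; congr (_ + _); apply: eq_bigr => i _.
  by rewrite (unsplitK (inl i)) scalerA.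
by rewrite (unsplitK (inr i)).
Qed.

Lemma filt_ind s (P : tensor_space K a -> Prop) : P 0 ->
  (forall b u w, filt z s u -> filt z s w -> P u -> P w -> P (b *: u + w)) ->
  (forall l, (word_deg l <= s)%N -> P (word_act z l (lowest_vec K a))) ->
  forall u, filt z s u -> P u.
Proof.
move=> P0 PD Pl u [r [c [l [ls ->]]]].
suff [] : filt z s (\sum_(i < r) c i *: word_act z (l i) (lowest_vec K a)) /\
  P (\sum_(i < r) c i *: word_act z (l i) (lowest_vec K a)) by [].
elim/big_ind: _ => [|v w [Fv Pv] [Fw Pw]|i _]; first by split=> //; apply: filt0.
  by rewrite -[v]scale1r; split; [apply: filt_lin | apply: PD].
rewrite -[_ *: _]addr0; split; first by apply: filt_lin (filt0 s); apply: filt_word.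
by apply: PD => //; [apply: filt_word | apply: filt0 | apply: Pl].
Qed.

Lemma filt_mono s t u : (s <= t)%N -> filt z s u -> filt z t u.
Proof.
move=> st; elim/filt_ind => [|b v w _ _|l ls]; first exact: filt0.
  exact: filt_lin.
exact: filt_word (leq_trans ls st).
Qed.

Lemma filt_act x j s u : filt z s u -> filt z (s + j) (eval_act z x j u).
Proof.
elim/filt_ind => [|b v w _ _ Fv Fw|l ls]; first by rewrite linear0; apply: filt0.
  by rewrite linearP; apply: filt_lin.
by apply: (@filt_word _ ((x, j) :: l)); rewrite /word_deg /= addnC leq_add2r.
Qed.

(* The polynomial prod_i (t - z_i) acts by zero on the evaluation modules, so
   x_j lowers the filtration degree as soon as n <= j. *)
Lemma filt_act_high x j s u : (n <= j)%N -> filt z s u ->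
  filt_pred z (s + j) (eval_act z x j u).
Proof.
move=> nj Fu; case: (posnP n) => [n0|n_gt0].
  have -> : eval_act z x j u = 0.
    by rewrite eval_actE big1 // => i; have := ltn_ord i; rewrite {2}n0.
  by case: (s + j)%N => //= k; apply: filt0.
pose P : {poly K} := \prod_(i < n) ('X - (z i)%:P).
have sP : size P = n.+1.
  by rewrite size_prod_XsubC [index_enum _]unlock -enumT size_enum_ord.
have PE i : z i ^+ n = - \sum_(l < n) P`_l * z i ^+ l.
  have : P.[z i] = 0.
    by rewrite /P (bigD1 i) //= hornerM hornerXsubC subrr mul0r.
  rewrite horner_coef sP big_ord_recr /=.
  have -> : P`_n = 1.
    have /monicP : P \is monic by apply: monic_prod => l _; apply: monicXsubC.
    by rewrite lead_coefE sP.
  by rewrite mul1r addrC => /eqP; rewrite addr_eq0 => /eqP.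
have -> : eval_act z x j u =
    - \sum_(l < n) P`_l *: eval_act z x (l + (j - n)) u.
  under [in RHS]eq_bigr => l _ do rewrite eval_actE scaler_sumr.
  rewrite exchange_big /= -sumrN eval_actE; apply: eq_bigr => i _.
  rewrite -{1}(subnKC nj) exprD PE mulNr scaleNr mulr_suml scaler_suml.
  by congr (- _); apply: eq_bigr => l _; rewrite scalerA exprD mulrA.
have sj_gt0 : (0 < s + j)%N by lia.
rewrite -(prednK sj_gt0).
rewrite /= -[X in filt _ _ X]addr0 -scaleN1r.
apply: filt_lin (filt0 _); elim/big_ind: _ => [|v w Fv Fw|l _]; first exact: filt0.
  by rewrite -[v]scale1r; apply: filt_lin.
rewrite -[_ *: _]addr0; apply: filt_lin (filt0 _).
apply: filt_mono (filt_act x _ Fu); have := ltn_ord l; lia.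
Qed.

Variable M : fusion_product a z.

Lemma fp_symb_ind (S : M -> Prop) : S 0 ->
  (forall b m m', S m -> S m' -> S (b *: m + m')) ->
  (forall s u, filt z s u -> S (fp_symb M s u)) -> forall m, S m.
Proof.
move=> S0 SD Ss m; have [D [u [Fu ->]]] := fp_symb_span m.
elim/big_ind: _ => // [m1 m2 S1 S2|s _]; last exact: Ss.
by rewrite -[m1]scale1r; apply: SD.
Qed.

Lemma fp_symb0 s : fp_symb M s 0 = 0.
Proof.
apply/fp_symb_ker; first exact: filt0.
by case: s => //= s; apply: filt0.
Qed.

(** In degree 0 the previous filtration step is zero, and [lowest_vec] has coordinate 1 at the
    all-zero index, which exists since each [a i] is positive. *)
Lemma fp_vec_neq0 : (forall i, 0 < a i)%N -> fp_vec M != 0.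
Proof.
move=> a_gt0; rewrite fp_vecE; apply/eqP => /fp_symb_ker /=.
have F0 : filt z 0 (lowest_vec K a) by apply: (@filt_word 0%N [::]).
move=> /(_ F0)/ffunP/(_ [ffun i => Ordinal (a_gt0 i)]).
rewrite !ffunE; case: forallP => [_ /eqP|[] i]; first by rewrite oner_eq0.
by rewrite ffunE.
Qed.

Lemma fp_act_high x j m : (n <= j)%N -> fp_act M x j m = 0.
Proof.
move=> nj; move: m; apply: fp_symb_ind => [|b m m' Sm Sm'|s u Fu].
- by rewrite linear0.
- by rewrite linearP /= Sm Sm' scaler0 addr0.
- by rewrite fp_actE //; apply/fp_symb_ker; [apply: filt_act|apply: filt_act_high].
Qed.

(** The relation holds before grading, and both composites raise the filtration degree by [i + j],
    so it passes to symbols. It recovers [h] from [e] and [f]. *)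
Lemma fp_act_comm i j m :
  fp_act M sl2_h (i + j) m =
  fp_act M sl2_e i (fp_act M sl2_f j m) - fp_act M sl2_f j (fp_act M sl2_e i m).
Proof.
pose phi := ((fp_act M sl2_e i \o fp_act M sl2_f j)
  - (fp_act M sl2_f j \o fp_act M sl2_e i))%VF.
have phiE m0 : phi m0 =
    fp_act M sl2_e i (fp_act M sl2_f j m0) - fp_act M sl2_f j (fp_act M sl2_e i m0).
  by rewrite add_lfunE opp_lfunE !comp_lfunE.
rewrite -phiE; move: m; apply: fp_symb_ind => [|b m m' Sm Sm'|s u Fu].
- by rewrite !linear0.
- by rewrite !linearP /= Sm Sm'.
rewrite phiE !fp_actE //; try exact: filt_act.
have eji : (s + j + i = s + (i + j))%N by rewrite addnA addnAC.
rewrite -eval_act_comm eji -addnA addrC -scaleN1r fp_symb_linear.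
- by rewrite scaleN1r addrC.
- by rewrite addnA; do 2!apply: filt_act.
- by rewrite -eji; do 2!apply: filt_act.
Qed.

(** The degree [s] symbol of a word of degree exactly [s] is the same word applied to [fp_vec M];
    words of smaller degree have symbol zero. *)
Lemma fp_cyclic (S : M -> Prop) :
  (forall b m m', S m -> S m' -> S (b *: m + m')) ->
  S (fp_vec M) -> (forall x j m, S m -> S (fp_act M x j m)) ->
  forall m, S m.
Proof.
move=> SD Sv SX; have S0 : S 0 by have := SD (-1) _ _ Sv Sv; rewrite scaleN1r addNr.
apply: fp_symb_ind => // s u Fu.
suff [] : filt z s u /\ S (fp_symb M s u) by [].
elim/filt_ind: Fu => [|b v w _ _ [Fv Sv'] [Fw Sw]|l].
- by rewrite fp_symb0; split=> //; apply: filt0.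
- by rewrite fp_symb_linear //; split; [apply: filt_lin | apply: SD].
move=> ls; split; first exact: filt_word.
move: ls; rewrite leq_eqVlt => /orP[/eqP <-|ls]; last first.
  suff -> : fp_symb M s (word_act z l (lowest_vec K a)) = 0 by [].
  apply/fp_symb_ker; first by apply: filt_word; apply: ltnW.
  by case: s ls => // s ls; apply: filt_word.
elim: l => [|[x j] l IH]; first by rewrite /= -fp_vecE.
rewrite /word_deg /= addnC -fp_actE; last exact: filt_word.
exact: SX.
Qed.

(** The group over [K[t]/t^n] gives access to [e_j] and [f_j] for [j < n] only. These suffice: [h_j]
    is the bracket of [e_j] and [f_0], and indices [j >= n] act by zero. *)
Lemma fp_cyclic_ef (S : M -> Prop) :
  (forall b m m', S m -> S m' -> S (b *: m + m')) ->
  S (fp_vec M) ->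
  (forall j m, (j < n)%N -> S m -> S (fp_act M sl2_e j m)) ->
  (forall j m, (j < n)%N -> S m -> S (fp_act M sl2_f j m)) ->
  forall m, S m.
Proof.
move=> SD Sv Se Sf.
have SB m m' : S m -> S m' -> S (m' - m).
  by move=> Sm Sm'; rewrite addrC -scaleN1r; apply: SD.
apply: fp_cyclic => // x j m Sm; case: (ltnP j n) => [jn|/fp_act_high ->]; last first.
  by rewrite -(subrr m); apply: SB.
case: x; [exact: Se | | exact: Sf].
have n_gt0 : (0 < n)%N by apply: leq_ltn_trans jn.
rewrite -(addn0 j) fp_act_comm.
by apply: SB; [apply: Sf => //; apply: Se | apply: Se => //; apply: Sf].
Qed.

End Fusion.

(** * Polynomials along curves and derivations by linear vector fields *)

Section PolynomialVectorFields.
Lemma mnmBB N (m : 'X_{1..N}) : (m - m)%MM = 0%MM.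
Proof. by apply/mnmP => i; rewrite mnmBE subnn mnm0E. Qed.


Lemma mpoly_ring_ind (R : comNzRingType) N (P : {mpoly R[N]} -> Prop) :
  (forall c, P c%:MP) -> (forall i, P 'X_i) ->
  (forall p q, P p -> P q -> P (p + q)) -> (forall p q, P p -> P q -> P (p * q)) ->
  forall p, P p.
Proof.
move=> PC PX PD PM p; rewrite [p]mpolyE.
elim/big_ind: _ => [||m _]; [by rewrite -mpolyC0; apply: PC | exact: PD |].
rewrite -mul_mpolyC; apply: (PM) => //; rewrite mpolyXE_id.
elim/big_ind: _ => [||i _]; [by rewrite -mpolyC1; apply: PC | exact: PM |].
elim: (m i) => [|k IH]; first by rewrite expr0 -mpolyC1; apply: PC.
by rewrite exprS; apply: PM.
Qed.

Lemma dhomog_ind (R : nzRingType) N d (P : {mpoly R[N]} -> Prop) : P 0 ->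
  (forall b p q, P p -> P q -> P (b *: p + q)) ->
  (forall m, mdeg m = d -> P 'X_[m]) -> forall p, p \is d.-homog -> P p.
Proof.
move=> P0 PD PX p /dhomogP hp; rewrite [p]mpolyE big_seq.
elim/big_ind: _ => // [q r Pq Pr|m mp]; first by rewrite -[q]scale1r; apply: PD.
by rewrite -[_ *: _]addr0; apply: PD => //; apply: PX; apply: hp.
Qed.

Lemma dhomog_mevalZ (R : comNzRingType) N d (s : R) (x : 'I_N -> R) p :
  p \is d.-homog -> p.@[fun i => s * x i] = s ^+ d * p.@[x].
Proof.
elim/dhomog_ind => [|b q r Hq Hr|m <-]; first by rewrite !meval0 mulr0.
  by rewrite !mevalD !mevalZ Hq Hr mulrDr mulrCA.
rewrite !mevalX mdegE expr_sum -big_split /=.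
by apply: eq_bigr => i _; rewrite exprMn.
Qed.

Variables (K : fieldType) (K0 : [pchar K] =i pred0).

Lemma poly_eq0_horner (P : {poly K}) : (forall s, P.[s] = 0) -> P = 0.
Proof.
move=> P0; pose rs := [seq k%:R : K | k <- iota 0 (size P)].
apply: (@roots_geq_poly_eq0 _ _ rs); last by rewrite size_map size_iota.
  by apply/allP => s _; rewrite /root P0.
rewrite map_inj_uniq ?iota_uniq // => k l /eqP kl.
have inj m m' : (m <= m')%N -> m'%:R == m%:R :> K -> m = m'.
  move=> mm; rewrite -subr_eq0 -natrB // (pcharf0P _).1 // subn_eq0 => mm'.
  by apply/eqP; rewrite eqn_leq mm.
by case: (leqP k l) => [/inj|/ltnW/inj] H; [apply: H | apply/esym/H]; rewrite // eq_sym.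
Qed.

Lemma poly_eq0_derivn (P : {poly K}) : (forall k, P^`(k).[0] = 0) -> P = 0.
Proof.
move=> P0; apply/polyP => k; have := P0 k.
rewrite horner_coef0 coef_derivn addn0 ffactnn coef0 -mulr_natr => /eqP.
by rewrite mulf_eq0 (pcharf0P _).1 // eqn0Ngt fact_gt0 orbF => /eqP.
Qed.

Variable N : nat.
Implicit Types (p q : {mpoly K[N]}) (c : 'I_N -> {poly K}).

(** The restriction of a polynomial to the curve with coordinates [c i], as a polynomial in the
    curve parameter. *)
Definition along c : {mpoly K[N]} -> {poly K} := mmap (@polyC K) c.
HB.instance Definition _ c := GRing.RMorphism.on (along c).

Lemma along_horner c p s : (along c p).[s] = p.@[fun i => (c i).[s]].
Proof.
elim/mpoly_ring_ind: p => [b|i|p q Hp Hq|p q Hp Hq].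
- by rewrite /along mmapC hornerC mevalC.
- by rewrite /along mmapX mmap1U mevalXU.
- by rewrite rmorphD hornerD Hp Hq mevalD.
- by rewrite rmorphM hornerM Hp Hq mevalM.
Qed.

(** The chain rule. Both sides are additive and obey the Leibniz rule over [along c], so constants
    and variables suffice. *)
Lemma along_deriv c p :
  (along c p)^`() = \sum_(i < N) (c i)^`() * along c p^`M(i).
Proof.
elim/mpoly_ring_ind: p => [b|i|p q Hp Hq|p q Hp Hq].
- rewrite /along mmapC derivC big1 // => i _.
  by rewrite mderivC mmap0 mulr0.
- rewrite /along mmapX mmap1U (bigD1 i) //= big1 => [|j ji].
    by rewrite mderivX mnm1E eqxx scale1r mnmBB mmapX mmap11 mulr1 addr0.
  by rewrite mderivX mnm1E eq_sym (negPf ji) scale0r mmap0 mulr0.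
- rewrite rmorphD derivD Hp Hq -big_split /=; apply: eq_bigr => i _.
  by rewrite mderivD rmorphD mulrDr.
- rewrite rmorphM derivM Hp Hq mulr_suml mulr_sumr -big_split /=.
  by apply: eq_bigr => i _; rewrite mderivM rmorphD !rmorphM; ring.
Qed.

Variables (V : vectType K) (v : N.-tuple V) (v_basis : basis_of {: V} v).
Variables (xi : 'I_N -> dual V).
Hypothesis xi_dual : forall i j : 'I_N, xi i (tnth v j) = (i == j)%:R.
Implicit Types (phi : 'End(V)) (m : V).

Lemma dual_coord m : m = \sum_(i < N) (xi i m : K) *: tnth v i.
Proof.
have mv : m \in <<v>>%VS by rewrite (span_basis v_basis) memvf.
rewrite {1}(coord_span mv); apply: eq_bigr => i _; rewrite -tnth_nth; congr (_ *: _).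
rewrite [in RHS](coord_span mv) linear_sum (bigD1 i) //= big1 => [|j ji].
  by rewrite -tnth_nth linearZ /= xi_dual eqxx addr0 /GRing.scale /= mulr1.
by rewrite -tnth_nth linearZ /= xi_dual eq_sym (negPf ji) scaler0.
Qed.

(** The [i]-th component of the vector field [m |-> phi m], as a linear form in the coordinates. *)
Definition pull phi i : {mpoly K[N]} :=
  \sum_(l < N) (xi i (phi (tnth v l)) : K) *: 'X_l.

Lemma pullE phi i m : (pull phi i).@[fun i => xi i m] = xi i (phi m).
Proof.
rewrite [in RHS](dual_coord m) /pull !linear_sum /=; apply: eq_bigr => l _.
by rewrite !linearZ /= mevalXU mulrC.
Qed.

(* The derivation of the polynomial functions on V given by the linear vector
   field m |-> phi m. *)
Definition lder phi p : {mpoly K[N]} := \sum_(i < N) pull phi i * p^`M(i).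

Fact lder_is_linear phi : linear (lder phi).
Proof.
move=> b p q; rewrite /lder scaler_sumr -big_split /=; apply: eq_bigr => i _.
by rewrite linearP mulrDr scalerAr.
Qed.
HB.instance Definition _ phi := GRing.isLinear.Build K {mpoly K[N]} {mpoly K[N]} _
  (lder phi) (lder_is_linear phi).

Lemma lder_sum r (c : 'I_r -> K) (phi : 'I_r -> 'End(V)) p :
  lder (\sum_(j < r) c j *: phi j) p = \sum_(j < r) c j *: lder (phi j) p.
Proof.
rewrite /lder; under [RHS]eq_bigr => j _ do rewrite scaler_sumr.
rewrite exchange_big /=; apply: eq_bigr => i _.
under [RHS]eq_bigr => j _ do rewrite scalerAl.
rewrite -mulr_suml; congr (_ * _); rewrite /pull.
under [RHS]eq_bigr => j _ do rewrite scaler_sumr.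
rewrite exchange_big /=; apply: eq_bigr => l _.
rewrite sum_lfunE linear_sum scaler_suml; apply: eq_bigr => j _.
by rewrite scale_lfunE linearZ /= scalerA.
Qed.

Lemma lderM phi p q : lder phi (p * q) = lder phi p * q + p * lder phi q.
Proof.
rewrite /lder mulr_suml mulr_sumr -big_split; apply: eq_bigr => i _ /=.
by rewrite mderivM; ring.
Qed.

Lemma lderX phi i : lder phi 'X_i = pull phi i.
Proof.
rewrite /lder (bigD1 i) //= big1 => [|j ji].
  by rewrite mderivX mnm1E eqxx scale1r mnmBB mpolyX0 mulr1 addr0.
by rewrite mderivX mnm1E eq_sym (negPf ji) scale0r mulr0.
Qed.

Lemma lder_homog phi d p : p \is d.-homog -> lder phi p \is d.-homog.
Proof.
elim/dhomog_ind => [|b q r Hq Hr|m md].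
- by rewrite linear0 rpred0.
- by rewrite linearP; apply: rpredD => //; apply: rpredZ.
(* When [m i = 0] the subtraction of exponents truncates, but the coefficient is then zero. *)
apply: rpred_sum => i _; rewrite mderivX -scalerAr; case: (posnP (m i)) => [->|mi].
  by rewrite scale0r rpred0.
apply: rpredZ; rewrite -md.
have -> : mdeg m = (1 + mdeg (m - U_(i)))%N.
  by rewrite -{1}(submK (m := U_(i)) (m' := m)) ?mdegD ?mdeg1 1?addnC // lep1mP -lt0n.
apply: dhomogM; last by rewrite dhomogX.
by apply: rpred_sum => l _; apply: rpredZ; rewrite dhomogX /= mdeg1.
Qed.

Lemma dual_eq0 m : (forall l : dual V, l m = 0) -> m = 0.
Proof.
by move=> l0; rewrite (dual_coord m) big1 // => i _; rewrite l0 scale0r.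
Qed.

(** The truncation bound is kept free; [D = \dim {: V}] gives [nilp_exp]. *)
Definition texp D phi m : V := \sum_(k < D.+1) (k`!%:R)^-1 *: iter k phi m.

Definition texp_curve D phi m (l : dual V) : {poly K} :=
  \poly_(k < D.+1) ((k`!%:R)^-1 * l (iter k phi m)).

Lemma iter_scale s phi k m : iter k (s *: phi) m = s ^+ k *: iter k phi m.
Proof.
elim: k => [|k IH]; first by rewrite scale1r.
by rewrite !iterS IH scale_lfunE linearZ /= scalerA exprS.
Qed.

Lemma texp_curveE D phi m (l : dual V) s :
  (texp_curve D phi m l).[s] = l (texp D (s *: phi) m).
Proof.
rewrite horner_poly linear_sum; apply: eq_bigr => k _.
by rewrite iter_scale !linearZ /= -mulrA [_ * s ^+ _]mulrC.
Qed.

Lemma texp_curve0 D phi m (l : dual V) : (texp_curve D phi m l)`_0 = l m.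
Proof. by rewrite coef_poly /= fact0 invr1 mul1r. Qed.

Lemma deriv_texp_curve D phi m (l : dual V) :
  (texp_curve D phi m l)^`() =
  \poly_(k < D) ((k`!%:R)^-1 * l (iter k.+1 phi m)).
Proof.
apply/polyP => k; rewrite coef_deriv !coef_poly ltnS.
case: ifP => // [_|]; last by rewrite mul0rn.
rewrite -[_ *+ k.+1]mulr_natr factS natrM mulrAC; congr (_ * _).
by rewrite invfM mulrC mulrA mulfV ?mul1r // (pcharf0P _).1.
Qed.

(* The nilpotence of phi is a consequence of the group law: equating the
   derivatives at s = 0 of the two sides of the hypothesis leaves only the term
   iter D.+1 phi m / D!. *)
Lemma texp_nilpotent D phi : (0 < D)%N ->
  (forall s m, texp D ((s + 1) *: phi) m = texp D (s *: phi) (texp D phi m)) ->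
  forall m, iter D.+1 phi m = 0.
Proof.
move=> D_gt0 texpD m; apply: dual_eq0 => l.
pose B := texp_curve D phi m l.
pose A := texp_curve D phi (texp D phi m) l.
have BA : B \Po ('X + 1%:P) = A.
  apply/eqP; rewrite -subr_eq0; apply/eqP/poly_eq0_horner => s.
  rewrite hornerD hornerN horner_comp !hornerE.
  by rewrite !texp_curveE texpD subrr.
have := congr1 (fun P : {poly K} => P^`().[0]) BA.
rewrite deriv_comp derivD derivX derivC addr0 mulr1 horner_comp !hornerE /=.
rewrite !deriv_texp_curve horner_poly horner_coef0 coef_poly D_gt0 invr1 mul1r /=.
rewrite /texp !linear_sum big_ord_recr /=.
under [in RHS]eq_bigr => k _ do rewrite !linearZ /=.
under eq_bigr => k _ do rewrite expr1n mulr1.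
move/eqP; rewrite !linearZ /= -[X in X == _]addr0 (inj_eq (addrI _)) eq_sym mulf_eq0.
by rewrite invr_eq0 (pcharf0P _).1 // eqn0Ngt fact_gt0 => /eqP.
Qed.

(** Differentiation at [s = 0]: the curve starts at [m] with velocity [phi m], the linear term being
    kept because [0 < D]. *)
Lemma lder_texp_coef1 D phi m p : (0 < D)%N ->
  (forall s, p.@[fun i => xi i (texp D (s *: phi) m)] = 0) ->
  (lder phi p).@[fun i => xi i m] = 0.
Proof.
move=> D_gt0 p0; pose c i := texp_curve D phi m (xi i).
have c0 : along c p = 0.
  apply: poly_eq0_horner => s; rewrite along_horner -[RHS](p0 s).
  by apply: meval_eq => i; apply: texp_curveE.
have := along_deriv c p; rewrite c0 deriv0 => /(congr1 (horner^~ 0)).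
rewrite horner0 horner_sum => /esym <-; rewrite raddf_sum /=; apply: eq_bigr => i _.
rewrite mevalM pullE hornerM along_horner; congr (_ * _).
  by rewrite horner_coef0 coef_deriv mulr1n coef_poly ltnS D_gt0 invr1 mul1r.
by apply: meval_eq => j; rewrite horner_coef0 texp_curve0.
Qed.

(** Nilpotence makes [s |-> texp D (s *: phi) m] an integral curve of [phi], so the derivatives of
    [p] along it are the restrictions of [iter k (lder phi) p]. All vanish at [s = 0], hence [p]
    vanishes along the curve, in particular at [s = 1]. *)
Lemma texp_lder D phi m p : (forall m, iter D.+1 phi m = 0) ->
  (forall k, (iter k (lder phi) p).@[fun i => xi i m] = 0) ->
  p.@[fun i => xi i (texp D phi m)] = 0.
Proof.
move=> phiD p0; pose c i := texp_curve D phi m (xi i).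
have cD i : (c i)^`() = along c (pull phi i).
  apply/polyP => k; rewrite /pull raddf_sum coef_sum deriv_texp_curve coef_poly.
  have -> : \sum_(l < N) (along c ((xi i (phi (tnth v l)) : K) *: 'X_l))`_k =
      if (k < D.+1)%N then (k`!%:R)^-1 * xi i (iter k.+1 phi m) else 0.
    under eq_bigr => l _ do
      rewrite /along /= mmapZ mmapX mmap1U coefCM coef_poly.
    case: ifP => _; last by rewrite big1 // => l _; rewrite mulr0.
    rewrite iterS [in RHS](dual_coord (iter k phi m)) !linear_sum mulr_sumr /=.
    by apply: eq_bigr => l _; rewrite !linearZ /= mulrC -mulrA; congr (_ * _).
  (* Nilpotence enters at [k = D] only: the derivative of the truncated curve has no term in
     [s ^ D], so [iter D.+1 phi m] has to vanish. *)
  case: (ltngtP k D) => [kD|kD|->]; rewrite ?ltnS ?leqnn ?phiD ?linear0 ?mulr0 //.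
    by rewrite ltnW.
  by rewrite leqNgt kD.
have cDp q : (along c q)^`() = along c (lder phi q).
  rewrite along_deriv /lder raddf_sum /=; apply: eq_bigr => i _.
  by rewrite rmorphM cD.
suff c0 : along c p = 0.
  have := along_horner c p 1; rewrite c0 horner0 => p1; rewrite [RHS]p1.
  by apply: meval_eq => i; rewrite texp_curveE scale1r.
apply: poly_eq0_derivn => k.
have -> : (along c p)^`(k) = along c (iter k (lder phi) p).
  by elim: k => [|k IH]; rewrite ?derivn0 // derivnS IH cDp.
rewrite along_horner -[RHS](p0 k); apply: meval_eq => i.
by rewrite horner_coef0 texp_curve0.
Qed.

End PolynomialVectorFields.

(** * Generation of the special linear group by elementary matrices *)

Section SpecialLinear.

Lemma det2 (A : comNzRingType) (g : 'M[A]_2) :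
  \det g = g 0 0 * g 1 1 - g 0 1 * g 1 0.
Proof.
rewrite (expand_det_row _ 0) !big_ord_recl big_ord0 addr0 /cofactor !det_mx11 !mxE /=.
rewrite expr0 mul1r expr1 mulN1r mulrN.
by congr (_ * g _ _ - g _ _ * g _ _); apply/val_inj.
Qed.

Variables (K : fieldType) (n : nat).
Implicit Types (P Q : trunc_poly K n) (g : 'M[trunc_poly K n]_2).

Lemma ord2P (i : 'I_2) : i = 0 \/ i = 1.
Proof. by case: i => [[|[|//]] ?]; [left|right]; apply: val_inj. Qed.

Lemma unip_mul i j P g k l :
  (unip i j P *m g) k l = g k l + (k == i)%:R * (P * g j l).
Proof.
rewrite /unip mulmxDl mul1mx -scalemxAl !mxE; congr (_ + _).
rewrite (bigD1 j) //= big1 => [|r rj]; last by rewrite mxE (negPf rj) andbF mul0r.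
by rewrite mxE eqxx andbT addr0 mulrCA.
Qed.

Lemma unipD i j P Q : i != j -> unip i j (P + Q) = unip i j P *m unip i j Q.
Proof.
move=> ij; rewrite /unip mulmxDl !mulmxDr !mul1mx mulmx1 -scalemxAl -scalemxAr.
have -> : delta_mx i j *m delta_mx i j = 0 :> 'M[trunc_poly K n]_2.
  by rewrite mul_delta_mx_0 // eq_sym.
by rewrite !scaler0 addr0 scalerDl -addrA [_ *: _ + _ *: _]addrC.
Qed.

Lemma det_unip_mul i j P g : i != j -> \det (unip i j P *m g) = \det g.
Proof.
move=> ij; rewrite det_mulmx [\det (unip _ _ _)]det2 /unip !mxE /=.
move: i j ij; move=> i j; case: (ord2P i) => ->; case: (ord2P j) => -> //= _;
by rewrite !(mulr0n, mulr1n, mulr0, mulr1, addr0, add0r, mul0r, subr0, mul1r).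
Qed.

(** The modulus is a positive power of ['X], even for [n = 0], so being a unit means being coprime
    to ['X]. *)
Lemma unitr_coef0 (P : trunc_poly K n) :
  (P \is a GRing.unit) = ((P : {poly K})`_0 != 0).
Proof.
rewrite unfold_in /=; move: (qpoly.polyn P) => p; rewrite mk_monic_Xn.
rewrite coprimep_pexpl // coprimep_sym.
by rewrite -['X]subr0 -polyC0 coprimep_XsubC rootE horner_coef0.
Qed.

Lemma truncM_coef0 P Q : (P * Q : {poly K})`_0 = P`_0 * Q`_0.
Proof.
rewrite poly_of_qpolyM; move: (qpoly.polyn P) (qpoly.polyn Q) => p q.
by rewrite mk_monic_Xn -Pdiv.RingMonic.take_poly_rmodp coef_take_poly /= coef0M.
Qed.

(** If the lower left entry is a unit, the matrix is an upper times a lower times an upper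
    elementary matrix. Otherwise adding the first row to the second makes that entry a unit, since
    the ring is local and the determinant is 1. *)
Lemma SL2_ind (S : 'M[trunc_poly K n]_2 -> Prop) : S 1%:M ->
  (forall P g, \det g = 1 -> S g -> S (unip 0 1 P *m g)) ->
  (forall P g, \det g = 1 -> S g -> S (unip 1 0 P *m g)) ->
  forall g, \det g = 1 -> S g.
Proof.
move=> S1 Se Sf.
have Su g : \det g = 1 -> g 1 0 \is a GRing.unit -> S g.
  move=> dg gu.
  (* The parameters are chosen to match every entry but the upper right one, which then follows from
     the determinant. *)
  have -> : g = unip 0 1 ((g 0 0 - 1) / g 1 0) *m
    (unip 1 0 (g 1 0) *m (unip 0 1 ((g 1 1 - 1) / g 1 0) *m 1%:M)).
    apply/matrixP => k l; move: dg; rewrite det2 => dg.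
    have {}dg : g 0 1 * g 1 0 = g 0 0 * g 1 1 - 1 by rewrite -dg opprB addrC subrK.
    case: (ord2P k) => ->; case: (ord2P l) => ->; rewrite !unip_mul !mxE //=;
      rewrite !(mulr0n, mulr1n, mulr0, mulr1, addr0, add0r, mul0r, subr0, mul1r).
    + by rewrite divrK // addrC subrK.
    + apply: (mulIr gu); rewrite [g 1 0 * (_ / _)]mulrC divrK // [1 + _]addrC subrK.
      rewrite mulrDl [_ * g 1 1 * _]mulrAC !divrK // dg; ring.
    + by [].
    + by rewrite mulrC divrK // addrC subrK.
  apply: (Se); first by rewrite !det_unip_mul ?det1.
  apply: (Sf); first by rewrite !det_unip_mul ?det1.
  by apply: (Se) => //; rewrite det1.
move=> g dg; case: (boolP (g 1 0 \is a GRing.unit)) => [|gnu]; first exact: Su.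
have -> : g = unip 1 0 (- 1) *m (unip 1 0 1 *m g).
  by rewrite mulmxA -unipD // addNr /unip scale0r addr0 mul1mx.
have dg' : \det (unip 1 0 1 *m g) = 1 by rewrite det_unip_mul.
apply: (Sf) => //; apply: Su => //.
rewrite unip_mul eqxx !mul1r unitr_coef0.
move: gnu; rewrite unitr_coef0 negbK => /eqP g10.
(* If [g 0 0] and [g 1 0] both had constant term zero, so would the determinant. *)
apply/eqP; rewrite coefD g10 add0r => g00; move: dg.
rewrite det2 => /(congr1 (fun P : trunc_poly K n => (P : {poly K})`_0)).
rewrite coefB !truncM_coef0 g00 g10 mul0r mulr0 subr0 coef1 /= => /esym/eqP.
by rewrite oner_eq0.
Qed.

End SpecialLinear.

(** * The group action through truncated exponentials *)

Section GroupElements.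
Variables (K : fieldType) (K0 : [pchar K] =i pred0).
Variables (n : nat) (a : 'I_n -> nat) (z : 'I_n -> K).
Variables (M : fusion_product a z) (rho : SL2_action M).
Hypothesis a_gt0 : forall i, (0 < a i)%N.
Implicit Types (P Q : trunc_poly K n) (g : 'M[trunc_poly K n]_2).

Lemma trunc_act_linear x : linear (trunc_act M x).
Proof.
move=> b P Q; rewrite /trunc_act scaler_sumr -big_split /=.
by apply: eq_bigr => j _; rewrite coefD coefZ scalerDl scalerA.
Qed.

Lemma trunc_act_Xn x j : (j < n)%N ->
  trunc_act M x (in_qpoly 'X^n 'X^j) = fp_act M x j.
Proof.
move=> jn; rewrite /trunc_act (bigD1 (Ordinal jn)) //= mk_monic_Xn.
have n_gt0 : (0 < n)%N by apply: leq_ltn_trans jn.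
rewrite -Pdiv.RingMonic.take_poly_rmodp prednK // coef_take_poly jn coefXn eqxx scale1r.
rewrite big1 ?addr0 // => i ij; rewrite coef_take_poly ltn_ord coefXn.
by rewrite (_ : (i == j :> nat) = false) ?scale0r //; apply/negbTE.
Qed.

Lemma dim_fusion_gt0 : (0 < \dim {: M})%N.
Proof.
rewrite lt0n dimv_eq0; apply/eqP => M0; have := fp_vec_neq0 M a_gt0.
by rewrite -memv0 -M0 memvf.
Qed.

Lemma gact_vec_neq0 g : \det g = 1 -> rho g (fp_vec M) != 0.
Proof.
move=> dg; apply/eqP => gv0; have := fp_vec_neq0 M a_gt0.
have gu : g \in unitmx by rewrite unitmxE dg unitr1.
rewrite -[fp_vec M]id_lfunE -(gact1 rho) -(mulVmx gu) gactM //; last first.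
  by rewrite det_inv dg invr1.
by rewrite comp_lfunE gv0 linear0 eqxx.
Qed.

(** Pairs [e] and [f] with the matrix position of their exponentials, so that both are treated at
    once. *)
Variant root_vector : sl2_basis -> 'I_2 -> 'I_2 -> Prop :=
  | RootE : root_vector sl2_e 0 1
  | RootF : root_vector sl2_f 1 0.

Lemma root_vector_neq x i j : root_vector x i j -> i != j.
Proof. by case. Qed.

Lemma gact_unip x i j P m : root_vector x i j ->
  rho (unip i j P) m = texp (\dim {: M}) (trunc_act M x P) m.
Proof. by case; [apply: gact_exp_e | apply: gact_exp_f]. Qed.

Lemma gact_unip_mul x i j P g m : root_vector x i j -> \det g = 1 ->
  rho (unip i j P *m g) m = texp (\dim {: M}) (trunc_act M x P) (rho g m).
Proof.
move=> r dg; rewrite gactM ?comp_lfunE ?(gact_unip _ _ r) //.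
by rewrite -[unip i j P]mulmx1 det_unip_mul ?det1 // (root_vector_neq r).
Qed.

(** Since [s |-> unip i j (s *: P)] is a one-parameter subgroup, the truncated exponentials satisfy
    the addition law that [texp_nilpotent] requires. *)
Lemma trunc_act_nilpotent N (v : N.-tuple M) (v_basis : basis_of {: M} v)
    (xi : 'I_N -> dual M)
    (xi_dual : forall i j : 'I_N, xi i (tnth v j) = (i == j)%:R) x i j P m :
  root_vector x i j -> iter (\dim {: M}).+1 (trunc_act M x P) m = 0.
Proof.
move=> r; apply: (texp_nilpotent K0 v_basis xi_dual dim_fusion_gt0) => s {}m.
have actZ t : t *: trunc_act M x P = trunc_act M x (t *: P).
  have := trunc_act_linear x t P 0; rewrite addr0 => ->.
  by rewrite [trunc_act M x 0]big1 ?addr0 // => k _; rewrite coef0 scale0r.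
rewrite !actZ -!(gact_unip _ _ r) scalerDl scale1r.
rewrite unipD ?(root_vector_neq r) // (gact_unip_mul _ _ r) ?(gact_unip _ _ r) //.
by rewrite -[unip i j P]mulmx1 det_unip_mul ?det1 // (root_vector_neq r).
Qed.

End GroupElements.

(** * Restriction of polynomials to the graded algebra, and vanishing on the orbit *)

Section CoordinateRing.
Variables (K : fieldType) (K0 : [pchar K] =i pred0).
Variables (n : nat) (a : 'I_n -> nat) (z : 'I_n -> K).
Variable M : forall k, fusion_product (Ak a k) z.
Variable rho : SL2_action (M 1%N).
Variable iota : forall k l, (0 < k)%N -> (0 < l)%N ->
  fusion_embedding (M (k + l)%N) (M k) (M l).
Variable F : FA_algebra iota.
Variables (N : nat) (v : N.-tuple (M 1%N)) (v_basis : basis_of {: M 1%N} v).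
Variable xi : 'I_N -> dual (M 1%N).
Hypothesis xi_dual : forall i j : 'I_N, xi i (tnth v j) = (i == j)%:R.

Notation vec k := (fp_vec (M k)).
Notation coords m := (fun i => xi i m).
Notation D x j := (lder v xi (fp_act (M 1%N) x j)).

HB.instance Definition _ := GRing.RMorphism.copy (FA_eval F xi)
  (mmap (in_alg F) (fun i => FA_in F 1%N (xi i))).

Lemma FA_evalZ b p : FA_eval F xi (b *: p) = b *: FA_eval F xi p.
Proof. by rewrite /FA_eval mmapZ mulr_algl. Qed.

Lemma FA_evalX i : FA_eval F xi 'X_i = FA_in F 1%N (xi i).
Proof. by rewrite /FA_eval mmapX mmap1U. Qed.

Lemma FA_in_eq0 k zeta : (0 < k)%N -> FA_in F k zeta = 0 -> zeta = 0.
Proof.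
move=> k_gt0 z0; pose eta := dfwith (fun k => 0 : dual (M k)) zeta.
have [|_ H] := @FA_direct _ _ _ _ _ _ F k.+1 0 eta.
  rewrite scale0r add0r big_nat_recr //= /eta dfwith_in z0 addr0.
  rewrite big_nat big1 // => i /andP[_ ik].
  by rewrite dfwith_out ?linear0 // gtn_eqF.
by have := H k; rewrite k_gt0 ltnS leqnn /eta dfwith_in => ->.
Qed.

Lemma FA_in_inj k : (0 < k)%N -> injective (FA_in F k).
Proof.
move=> k_gt0 zeta eta e; apply/eqP; rewrite -subr_eq0.
by apply/eqP/(FA_in_eq0 k_gt0); rewrite linearB /= e subrr.
Qed.

(** [FA_mul] takes the product functional as given; here it is built, as [zeta (x) eta] composed
    with the embedding. *)
Lemma FA_mul_ex k l (k_gt0 : (0 < k)%N) (l_gt0 : (0 < l)%N)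
    (zeta : dual (M k)) (eta : dual (M l)) :
  exists theta : dual (M (k + l)%N),
    forall w, theta w = eta (iota k_gt0 l_gt0 w zeta).
Proof.
pose f w : K^o := eta (iota k_gt0 l_gt0 w zeta).
have f_lin : linear f.
  by move=> b u w; rewrite /f linearP add_lfunE scale_lfunE linearP.
pose fL := GRing.isLinear.Build K (M (k + l)%N) K^o _ f f_lin.
pose fl : {linear M (k + l)%N -> K^o} := HB.pack f fL.
by exists (linfun fl) => w; rewrite lfunE.
Qed.

(* zeta stands for the restriction of p to M k along the iterated embedding of
   M k into the k-th tensor power of M 1. Instead of that embedding we record
   the properties of the restriction that the proof needs. *)
Definition restricts k (p : {mpoly K[N]}) (zeta : dual (M k)) : Prop :=
  [/\ FA_in F k zeta = FA_eval F xi p,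
      zeta (vec k) = p.@[coords (vec 1%N)] &
      forall x j, FA_in F k (zeta \o fp_act (M k) x j)%VF = FA_eval F xi (D x j p)].

Lemma restricts0 k : restricts (k := k) 0 0.
Proof.
split=> [||x j]; rewrite ?linear0 ?rmorph0 ?zero_lfunE //.
by rewrite comp_lfun0l linear0.
Qed.

Lemma restricts_lin k b p q zeta eta : restricts (k := k) p zeta ->
  restricts q eta -> restricts (b *: p + q) (b *: zeta + eta).
Proof.
move=> [p1 p2 p3] [q1 q2 q3]; split=> [||x j].
- by rewrite linearP rmorphD /= FA_evalZ p1 q1.
- by rewrite add_lfunE scale_lfunE p2 q2 mevalD mevalZ.
- rewrite comp_lfunDl -comp_lfunZl !linearP /= p3 q3.
  by rewrite rmorphD /= FA_evalZ.
Qed.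

Lemma restricts_X i : restricts 'X_i (xi i).
Proof.
split=> [||x j]; rewrite ?FA_evalX ?mevalXU // lderX.
rewrite /pull rmorph_sum /=.
under eq_bigr => l _ do rewrite FA_evalZ FA_evalX -linearZ.
rewrite -linear_sum; congr (FA_in F _ _); apply/lfunP => m.
rewrite sum_lfunE comp_lfunE {1}(dual_coord v_basis xi_dual m) !linear_sum.
apply: eq_bigr => l _.
by rewrite scale_lfunE !linearZ /GRing.scale /= mulrC.
Qed.

(** The embedding maps the cyclic vector to the tensor product of the cyclic vectors, so values
    there multiply. Its equivariance yields the Leibniz rule, which [lder] obeys as well. *)
Lemma restricts_mul k l p q zeta eta : (0 < k)%N -> (0 < l)%N ->
  restricts (k := k) p zeta -> restricts (k := l) q eta ->
  exists theta, restricts (k := (k + l)%N) (p * q) theta.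
Proof.
move=> k_gt0 l_gt0 [p1 p2 p3] [q1 q2 q3].
have [theta thetaE] := FA_mul_ex k_gt0 l_gt0 zeta eta; exists theta.
split=> [||x j].
- by rewrite rmorphM /= -p1 -q1 (FA_mul F thetaE).
- rewrite thetaE emb_vec /pure_tensor linearZ /= p2 q2.
  by rewrite mevalM.
have [theta1 theta1E] := FA_mul_ex k_gt0 l_gt0 (zeta \o fp_act _ x j)%VF eta.
have [theta2 theta2E] := FA_mul_ex k_gt0 l_gt0 zeta (eta \o fp_act _ x j)%VF.
have -> : (theta \o fp_act _ x j)%VF = theta1 + theta2.
  apply/lfunP => w; rewrite add_lfunE comp_lfunE thetaE theta1E theta2E.
  by rewrite emb_act /tensor_act linearD /= comp_lfunE.
rewrite linearD /= -(FA_mul F theta1E) -(FA_mul F theta2E) lderM rmorphD !rmorphM /=.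
by rewrite p3 q3 p1 q1.
Qed.

(** By linearity monomials suffice; variables are split off one at a time, down to degree one. *)
Lemma restricts_ex k p : (0 < k)%N -> p \is k.-homog ->
  exists zeta, restricts (k := k) p zeta.
Proof.
move=> k_gt0; elim/dhomog_ind => [|b q r [zeta Hq] [eta Hr]|].
- by exists 0; apply: restricts0.
- by exists (b *: zeta + eta); apply: restricts_lin.
case: k k_gt0 => // k _; elim: k => [|k IH] m mk.
  have /mdeg1P[i /eqP ->] : mdeg m == 1%N by rewrite mk.
  by exists (xi i); apply: restricts_X.
have [i mi] : exists i, (U_(i) <= m)%MM.
  case: (pickP (fun i => m i != 0%N)) => [i mi|m0]; first by exists i; rewrite lep1mP.
  by move: mk; rewrite mdegE big1 // => i _; apply/eqP/negbFE/m0.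
rewrite -(submK mi) addmC mpolyXD.
have [|zeta Hz] := IH (m - U_(i))%MM.
  by apply: succn_inj; rewrite -mk -{2}(submK mi) mdegD mdeg1 addn1.
exact: restricts_mul (restricts_X i) Hz.
Qed.

(** The third clause of [restricts] speaks of first derivatives only. The derivative, again
    homogeneous of degree [k], has some restriction, and injectivity of [FA_in] identifies it with
    the composite; so derivatives can be iterated. *)
Lemma restricts_lder k p zeta x j : (0 < k)%N -> p \is k.-homog ->
  restricts p zeta -> restricts (D x j p) (zeta \o fp_act (M k) x j)%VF.
Proof.
move=> k_gt0 hp [_ _ Hz].
have [eta He] := restricts_ex k_gt0 (lder_homog v xi (fp_act (M 1%N) x j) hp).
suff <- : eta = (zeta \o fp_act (M k) x j)%VF by [].
by apply: (FA_in_inj k_gt0); rewrite Hz; case: He.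
Qed.

Let Ak_gt0 k i : (0 < Ak a k i)%N. Proof. by rewrite /Ak addn1. Qed.

Definition vanishes p := forall g, \det g = 1 -> p.@[coords (rho g (vec 1%N))] = 0.

(** The curve [s |-> exp (s x_j) g v] stays in the orbit, so [p] is zero along it, and so is its
    derivative at [s = 0]. *)
Lemma vanishes_lder x i i' j p : root_vector x i i' -> (j < n)%N ->
  vanishes p -> vanishes (D x j p).
Proof.
move=> r jn p0 g dg.
apply: (lder_texp_coef1 K0 v_basis xi_dual (dim_fusion_gt0 (M 1%N) (Ak_gt0 _))) => s.
have -> : s *: fp_act (M 1%N) x j = trunc_act (M 1%N) x (s *: in_qpoly 'X^n 'X^j).
  have := trunc_act_linear (M 1%N) x s (in_qpoly 'X^n 'X^j) 0; rewrite addr0 => ->.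
  rewrite [trunc_act _ x 0]big1 ?addr0 => [|k _]; last by rewrite coef0 scale0r.
  by rewrite trunc_act_Xn.
rewrite -(gact_unip_mul rho _ _ r dg); apply: p0.
by rewrite det_unip_mul // (root_vector_neq r).
Qed.

Lemma vanishes_FA_eval0 d p : (0 < d)%N -> p \is d.-homog -> vanishes p ->
  FA_eval F xi p = 0.
Proof.
move=> d_gt0 hp p0; have [zeta Hz] := restricts_ex d_gt0 hp.
suff z0 : zeta = 0 by case: Hz => <-; rewrite z0 linear0.
apply/lfunP => w; rewrite zero_lfunE.
(* Keeping [p] and [zeta] general in the induction on [w] lets [x_j] move from the vector to the
   polynomial, whose derivative still vanishes on the orbit. *)
move: w p hp p0 zeta Hz; apply: fp_cyclic_ef =>
  [b m m' Sm Sm'||j m jn Sm|j m jn Sm] p hp p0 zeta Hz.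
- by rewrite linearP /= (Sm _ hp p0 _ Hz) (Sm' _ hp p0 _ Hz) scaler0 addr0.
- case: Hz => _ -> _; have := p0 _ (det1 _ _).
  by under meval_eq => i do rewrite gact1 id_lfunE.
- rewrite -comp_lfunE; apply: Sm (restricts_lder _ _ d_gt0 hp Hz).
    exact: lder_homog.
  exact: vanishes_lder RootE jn p0.
- rewrite -comp_lfunE; apply: Sm (restricts_lder _ _ d_gt0 hp Hz).
    exact: lder_homog.
  exact: vanishes_lder RootF jn p0.
Qed.

(** The restriction of [p] is zero, hence so are its composites with the [x_j], which represent the
    derivatives. *)
Lemma FA_eval0_lder d p x P : (0 < d)%N -> p \is d.-homog ->
  FA_eval F xi p = 0 -> FA_eval F xi (lder v xi (trunc_act (M 1%N) x P) p) = 0.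
Proof.
move=> d_gt0 hp p0; have [zeta [z1 _ z3]] := restricts_ex d_gt0 hp.
have z0 : zeta = 0 by apply: (FA_in_eq0 d_gt0); rewrite z1.
rewrite /trunc_act lder_sum rmorph_sum big1 // => j _ /=.
by rewrite FA_evalZ -z3 z0 comp_lfun0l linear0 scaler0.
Qed.

Lemma FA_eval0_vanishes d p : (0 < d)%N -> p \is d.-homog ->
  FA_eval F xi p = 0 -> vanishes p.
Proof.
move=> d_gt0 hp p0 g dg; move: g dg p hp p0.
(* The iterated derivatives of [p] stay homogeneous of degree [d] and in the kernel, so they vanish
   at [g v] by the assumption on [g]; Taylor expansion carries this over to [unip i j P *m g]. *)
have step x i j P g : root_vector x i j -> \det g = 1 ->
  (forall p, p \is d.-homog -> FA_eval F xi p = 0 ->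
    p.@[coords (rho g (vec 1%N))] = 0) ->
  forall p, p \is d.-homog -> FA_eval F xi p = 0 ->
    p.@[coords (rho (unip i j P *m g) (vec 1%N))] = 0.
  move=> r dg Sg p hp p0.
  under meval_eq => l do rewrite (gact_unip_mul rho _ _ r dg).
  apply: (texp_lder K0 v_basis xi_dual).
    by move=> m; apply: (trunc_act_nilpotent K0 rho (Ak_gt0 _) v_basis xi_dual _ _ r).
  move=> k; set q := iter _ _ _.
  suff [hq q0] : q \is d.-homog /\ FA_eval F xi q = 0 by apply: Sg.
  rewrite /q; elim: k {q} => [|k [hq q0]] //=.
  by split; [apply: lder_homog | apply: FA_eval0_lder hq q0].
apply: SL2_ind => [p hp p0|P g dg Sg|P g dg Sg].
- have [zeta [z1 z2 _]] := restricts_ex d_gt0 hp.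
  under meval_eq => l do rewrite gact1 id_lfunE.
  by rewrite -z2 (FA_in_eq0 d_gt0 (zeta := zeta)) ?zero_lfunE // z1.
- exact: step RootE dg Sg.
- exact: step RootF dg Sg.
Qed.

Lemma vanishesP d p : p \is d.-homog -> vanishes p <-> FA_eval F xi p = 0.
Proof.
case: (posnP d) => [-> hp|d_gt0 hp]; last first.
  by split; [apply: vanishes_FA_eval0 hp | apply: FA_eval0_vanishes hp].
(* In degree zero [p] is a constant, and [FA_direct] with an empty sum shows that scalars embed in
   the algebra. *)
have [c ->] : exists c, p = c%:MP.
  elim/dhomog_ind: hp => [|b q r [c ->] [c' ->]|m].
  - by exists 0; rewrite mpolyC0.
  - by exists (b * c + c'); rewrite mpolyCD mpolyCM mul_mpolyC.
  - by move=> /eqP; rewrite mdeg_eq0 => /eqP ->; exists 1; rewrite mpolyX0 mpolyC1.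
rewrite /FA_eval mmapC; split=> [/(_ _ (det1 _ _))|c0 g _].
  by rewrite mevalC => ->; rewrite /= scale0r.
have [|-> _] := @FA_direct _ _ _ _ _ _ F 0 c (fun k => 0); last by rewrite mevalC.
by rewrite big_geq // addr0.
Qed.

(** The closure adds no condition: if [p] vanishes on the orbit, its zero locus is a closed set
    containing all orbit lines. *)
Lemma schubertP d p : p \is d.-homog ->
  (forall x : 'I_N -> K,
     schubert rho <[\sum_(i < N) x i *: tnth v i]>%VS -> p.@[x] = 0) <->
  vanishes p.
Proof.
move=> hp; split=> [p0 g dg|p0 x].
  apply: p0 => Z _; apply; exists g; split=> //.
  by rewrite -(dual_coord v_basis xi_dual).
have xiE i : xi i (\sum_(i < N) x i *: tnth v i) = x i.
  rewrite linear_sum (bigD1 i) //= big1 => [|l li].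
    by rewrite linearZ /= xi_dual eqxx addr0 /GRing.scale /= mulr1.
  by rewrite linearZ /= xi_dual eq_sym (negPf li) scaler0.
pose phi m := p.@[coords m].
pose Z (L : {vspace M 1%N}) := \dim L = 1%N /\ forall m, m \in L -> phi m = 0.
(* By homogeneity, vanishing at a spanning vector extends to its whole line. *)
have phiZ s m : phi (s *: m) = s ^+ d * phi m.
  rewrite /phi -(dhomog_mevalZ _ _ hp); apply: meval_eq => i.
  by rewrite linearZ.
have Z_closed : zariski_closed Z.
  exists (eq phi); split=> [_ <-|L]; first by exists N, d, xi, p.
  by split=> -[dL L0]; split=> //; [move=> _ <- | apply: L0].
have Z_orbit L : orbit_line rho L -> Z L.
  move=> [g [dg ->]]; split; first by rewrite dim_vline gact_vec_neq0.
  by move=> m /vlineP[s ->]; rewrite phiZ /phi p0 // mulr0.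
move=> sch; have [_ Zx] := sch Z Z_closed Z_orbit.
rewrite -[RHS](Zx _ (memv_line _)); apply: meval_eq => i.
by rewrite xiE.
Qed.

End CoordinateRing.

Theorem proposition3p1 (R : realType) (n : nat) (a : 'I_n -> nat)
  (a_gt0 : forall i, (0 < a i)%N)
  (a_incr : forall i j : 'I_n, (i < j)%N -> (a i < a j)%N)
  (z : 'I_n -> R[i]) (z_inj : injective z)
  (M : forall k, fusion_product (Ak a k) z)
  (rho : SL2_action (M 1%N))
  (iota : forall k l, (0 < k)%N -> (0 < l)%N ->
     fusion_embedding (M (k + l)%N) (M k) (M l))
  (F : FA_algebra iota)
  (N : nat) (v : N.-tuple (M 1%N)) (v_basis : basis_of {: M 1%N} v)
  (xi : 'I_N -> dual (M 1%N))
  (xi_dual : forall i j : 'I_N, xi i (tnth v j) = (i == j)%:R)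
  (d : nat) (p : {mpoly R[i][N]}) (p_homog : p \is d.-homog) :
  (forall x : 'I_N -> R[i],
     schubert rho <[\sum_(i < N) x i *: tnth v i]>%VS -> p.@[x] = 0)
  <-> FA_eval F xi p = 0.
Proof.
have K0 : [pchar R[i]] =i pred0 by apply: Num.Theory.pchar_num.
exact: iff_trans (schubertP rho v_basis xi_dual p_homog)
  (vanishesP K0 rho F v_basis xi_dual p_homog).
Qed.
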